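(* Let $\mathfrak{g}_{2|2}^{1}$ and $\mathfrak{g}_{2|2}^{2}$ be the complex Lie superalgebras of dimension $2|2$ with basis $\{e_1,e_2\mid e_3,e_4\}$ ($e_1,e_2$ even, $e_3,e_4$ odd) and nontrivial brackets $$\mathfrak{g}_{2|2}^{1}:\ [e_4,e_4]=e_1,\ [e_2,e_4]=e_3;\qquad \mathfrak{g}_{2|2}^{2}:\ [e_3,e_4]=e_1,\ [e_2,e_3]=e_3,\ [e_2,e_4]=-e_4.$$ Then $\mathfrak{g}_{2|2}^{1}$ has only one (nontrivial) metric deformation, up to equivalence and change of parameter, and it is a jump deformation to $\mathfrak{g}_{2|2}^{2}$.
   Context: All Lie superalgebras are over $\mathbb{C}$. Brackets of basis elements that are not listed are zero or determined by $[y,x]=-(-1)^{|x||y|}[x,y]$. A metric Lie superalgebra is a Lie superalgebra together with an even, non-degenerate, supersymmetric bilinear form $B$ that is invariant: $B([x,y],z)=B(x,[y,z])$. A formal 1-parameter deformation of a Lie superalgebra $(\mathfrak g,[\ ,\ ])$ is a $\mathbb{C}[[t]]$-bilinear Lie superalgebra structure on $\mathfrak g[[t]]=\mathfrak g\otimes_{\mathbb C}\mathbb{C}[[t]]$ of the form $[\ ,\ ]_t=[\ ,\ ]+\sum_{i\ge1}t^i\phi_i$, each $\phi_i:\mathfrak g\times\mathfrak g\to\mathfrak g$ being an even super-skew-symmetric bilinear map. Two such deformations $[\ ,\ ]_t,[\ ,\ ]'_t$ are equivalent if there is $\widehat\psi_t=\mathrm{id}+\psi_1t+\psi_2t^2+\cdots$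 with even linear $\psi_i:\mathfrak g\to\mathfrak g$ and $\widehat\psi_t([x,y]_t)=[\widehat\psi_t(x),\widehat\psi_t(y)]'_t$ for all $x,y\in\mathfrak g$. A deformation is trivial if it is equivalent to the original bracket. A metric deformation is a formal 1-parameter deformation that defines a metric Lie superalgebra, i.e. $(\mathfrak g[[t]],[\ ,\ ]_t)$ admits an even, supersymmetric, invariant $\mathbb{C}[[t]]$-bilinear form that is non-degenerate over $\mathbb{C}[[t]]$ (induces an isomorphism with the dual module). A deformation is a jump deformation to $\mathfrak h$ if for every non-zero value of $t$ near the origin it gives an algebra isomorphic to the same Lie superalgebra $\mathfrak h$, which is not isomorphic to $\mathfrak g$. *)

(* Defs.v *)
From HB Require Import structures.
From mathcomp Require Import all_boot all_order all_algebra.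
From mathcomp Require Import complex.
From mathcomp Require Import all_classical all_reals all_analysis.
From mathcomp Require Import ring.

Set Implicit Arguments.
Unset Strict Implicit.
Unset Printing Implicit Defensive.

Import Order.TTheory GRing.Theory Num.Theory.
Import numFieldNormedType.Exports.
Local Open Scope classical_set_scope.
Local Open Scope ring_scope.

(** * Formal power series *)

(* A record rather than an alias of [nat -> K], which already carries the
   pointwise product. *)
Record fps (K : Type) := Fps { fcoef : nat -> K }.

HB.instance Definition _ (K : Type) := [isNew for @fcoef K].
HB.instance Definition _ (K : choiceType) := [Choice of fps K by <:].

Section FpsRing.
Variable K : comNzRingType.
Implicit Types f g h : fps K.

Lemma fpsP f g : (forall n, fcoef f n = fcoef g n) -> f = g.
Proof. by case: f g => [f] [g] /= /funext ->. Qed.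

Definition fpsC (c : K) : fps K := Fps (fun n => if n == 0%N then c else 0).
Definition fps_opp f : fps K := Fps (fun n => - fcoef f n).
Definition fps_add f g : fps K := Fps (fun n => fcoef f n + fcoef g n).
Definition fps_mul f g : fps K :=
  Fps (fun n => \sum_(i < n.+1) fcoef f i * fcoef g (n - i)%N).

Fact fps_addA : associative fps_add.
Proof. by move=> f g h; apply: fpsP => n /=; rewrite addrA. Qed.
Fact fps_addC : commutative fps_add.
Proof. by move=> f g; apply: fpsP => n /=; rewrite addrC. Qed.
Fact fps_add0 : left_id (fpsC 0) fps_add.
Proof. by move=> f; apply: fpsP => n /=; rewrite if_same add0r. Qed.
Fact fps_addN : left_inverse (fpsC 0) fps_opp fps_add.
Proof. by move=> f; apply: fpsP => n /=; rewrite if_same addNr. Qed.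

HB.instance Definition _ :=
  GRing.isZmodule.Build (fps K) fps_addA fps_addC fps_add0 fps_addN.

Let trunc (m : nat) f : {poly K} := \poly_(i < m) fcoef f i.

Let fps_mul_trunc m f g n : (n < m)%N ->
  fcoef (fps_mul f g) n = (trunc m f * trunc m g)`_n.
Proof.
move=> nm; rewrite coefM; apply: eq_bigr => i _ /=; rewrite !coef_poly.
rewrite (leq_ltn_trans (leq_subr _ _) nm).
by rewrite (leq_ltn_trans _ nm) // -ltnS.
Qed.

Let trunc_coef m f n : (n < m)%N -> fcoef f n = (trunc m f)`_n.
Proof. by move=> nm; rewrite coef_poly nm. Qed.

Fact fps_mulA : associative fps_mul.
Proof.
move=> f g h; apply: fpsP => n.
transitivity ((trunc n.+1 f * (trunc n.+1 g * trunc n.+1 h))`_n).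
  rewrite coefM /=; apply: eq_bigr => i _.
  by rewrite -fps_mul_trunc ?ltnS ?leq_subr // -trunc_coef.
rewrite mulrA coefM /=; apply: eq_bigr => i _.
by rewrite -fps_mul_trunc // -trunc_coef // ltnS leq_subr.
Qed.

Fact fps_mulC : commutative fps_mul.
Proof.
by move=> f g; apply: fpsP => n; rewrite !(@fps_mul_trunc n.+1) // mulrC.
Qed.

Fact fps_mul1 : left_id (fpsC 1) fps_mul.
Proof.
move=> f; apply: fpsP => n /=; rewrite big_ord_recl /= mul1r subn0.
by rewrite big1 ?addr0 // => i _; rewrite mul0r.
Qed.

Fact fps_mulDl : left_distributive fps_mul fps_add.
Proof.
move=> f g h; apply: fpsP => n /=; rewrite -big_split /=.
by apply: eq_bigr => i _; rewrite mulrDl.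
Qed.

Fact fps_1_neq0 : fpsC 1 != 0.
Proof.
by apply/eqP => /(congr1 (fun f => fcoef f 0)) /= /eqP; rewrite oner_eq0.
Qed.

HB.instance Definition _ := GRing.Zmodule_isComNzRing.Build (fps K)
  fps_mulA fps_mulC fps_mul1 fps_mulDl fps_1_neq0.

(* [f] at the power series [u]; meaningful only when [u] has zero constant
   term, in which case the sum below contains all nonzero contributions. *)
Definition fps_subst (u f : fps K) : fps K :=
  Fps (fun n => \sum_(k < n.+1) fcoef f k * fcoef (u ^+ k) n).

End FpsRing.

(** * Lie superalgebras on the free module of rank [p|q] *)

(* The rank [p|q] free module over [A] is ['rV[A]_(p + q)]: the first [p]
   coordinates are even, the last [q] are odd. *)
Definition bracket (A : Type) (p q : nat) :=
  'rV[A]_(p + q) -> 'rV[A]_(p + q) -> 'rV[A]_(p + q).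

Section LieSuper.
Variables (A : comNzRingType) (p q : nat).
Local Notation V := 'rV[A]_(p + q).

Definition homogeneous (a : bool) (x : V) : Prop :=
  forall i : 'I_(p + q), (p <= i)%N != a -> x 0 i = 0.

Definition even_map (f : V -> V) : Prop :=
  forall a x, homogeneous a x -> homogeneous a (f x).

Record is_lie_superalgebra (b : bracket A p q) : Prop := {
  lie_linearr : forall x, linear (b x);
  lie_linearl : forall y, linear (b ^~ y);
  lie_graded : forall a c x y, homogeneous a x -> homogeneous c y ->
    homogeneous (a (+) c) (b x y);
  lie_skew : forall a c x y, homogeneous a x -> homogeneous c y ->
    b y x = - ((-1) ^+ (a && c) *: b x y);
  lie_jacobi : forall a c x y z, homogeneous a x -> homogeneous c y ->
    b x (b y z) = b (b x y) z + (-1) ^+ (a && c) *: b y (b x z) }.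

Record is_invariant_metric (b : bracket A p q) (B : V -> V -> A) : Prop := {
  metric_linearr : forall x, scalar (B x);
  metric_linearl : forall y, scalar (B ^~ y);
  metric_even : forall a c x y, homogeneous a x -> homogeneous c y ->
    a != c -> B x y = 0;
  metric_sym : forall a c x y, homogeneous a x -> homogeneous c y ->
    B y x = (-1) ^+ (a && c) * B x y;
  metric_invariant : forall x y z, B (b x y) z = B x (b y z);
  metric_nondegenerate : forall l : {scalar V}, exists! x, forall y, l y = B x y }.

Definition is_metric_lie_superalgebra (b : bracket A p q) : Prop :=
  is_lie_superalgebra b /\ exists B, is_invariant_metric b B.

Definition isomorphic (b b' : bracket A p q) : Prop :=
  exists f : V -> V, [/\ linear f, even_map f, bijective f &
    forall x y, f (b x y) = b' (f x) (f y)].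

End LieSuper.

(* Image of a bilinear bracket under a change of scalars [f], applied to its
   structure constants. *)
Definition map_bracket (A A' : comNzRingType) (p q : nat) (f : A -> A')
    (b : bracket A p q) : bracket A' p q :=
  fun x y => \sum_i \sum_j
    (x 0 i * y 0 j) *: map_mx f (b (delta_mx 0 i) (delta_mx 0 j)).

(** * Formal deformations *)

Section Deformation.
Variables (K : comNzRingType) (p q : nat).
Local Notation V := 'rV[K]_(p + q).
Local Notation Vt := 'rV[fps K]_(p + q).

Definition cst : V -> Vt := map_mx (@fpsC K).
Definition vcoef (n : nat) : Vt -> V := map_mx (fun f => fcoef f n).

(* [phi_n x y] is [vcoef n (bt (cst x) (cst y))]; the [phi_n] are even, bilinear
   and super-skew-symmetric because [bt] is so over [K[[t]]]. *)
Definition is_deformation (g : bracket K p q) (bt : bracket (fps K) p q) :=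
  is_lie_superalgebra bt /\
  forall x y, vcoef 0 (bt (cst x) (cst y)) = g x y.

Definition is_metric_deformation (g : bracket K p q)
    (bt : bracket (fps K) p q) :=
  is_deformation g bt /\ is_metric_lie_superalgebra bt.

Definition equivalent_deformations (bt bt' : bracket (fps K) p q) : Prop :=
  exists psi : Vt -> Vt, [/\ linear psi, even_map psi,
    (forall x, vcoef 0 (psi (cst x)) = x) &
    forall x y, psi (bt x y) = bt' (psi x) (psi y)].

Definition is_trivial_deformation (g : bracket K p q)
    (bt : bracket (fps K) p q) :=
  equivalent_deformations bt (map_bracket (@fpsC K) g).

(* Formal changes of parameter are the substitutions [t := u(t)] with
   [u] nonzero and [u(0) = 0]; they need not be invertible, e.g. [t := t ^ 2]. *)
Definition is_parameter_change (u : fps K) : Prop :=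
  fcoef u 0 = 0 /\ u <> 0.

Definition change_parameter (u : fps K) (bt : bracket (fps K) p q) :
    bracket (fps K) p q :=
  map_bracket (fps_subst u) bt.

End Deformation.

Section Jump.
Variables (K : numFieldType) (p q : nat).

(* The series [\sum_n phi_n z ^ n] converges to [b]. *)
Definition is_value_at (bt : bracket (fps K) p q) (z : K)
    (b : bracket K p q) : Prop :=
  forall x y k, series (fun n => vcoef n (bt (cst x) (cst y)) 0 k * z ^+ n)
    @ \oo --> b x y 0 k.

Definition is_jump_deformation (g : bracket K p q) (bt : bracket (fps K) p q)
    (h : bracket K p q) : Prop :=
  (\forall z \near (0 : K)^', exists b, is_value_at bt z b /\ isomorphic b h) /\
  ~ isomorphic g h.

End Jump.

(** * The two Lie superalgebras of dimension [2|2] *)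

Section Examples.
Variable K : comNzRingType.
Local Notation V := 'rV[K]_(2 + 2).

(* 1-based: the basis is [e 1, e 2 | e 3, e 4]. *)
Definition e (k : nat) : V := delta_mx 0 (inord k.-1).
Definition coord (k : nat) (x : V) : K := x 0 (inord k.-1).

Definition g1 : bracket K 2 2 := fun x y =>
  (coord 4 x * coord 4 y) *: e 1 +
  (coord 2 x * coord 4 y - coord 4 x * coord 2 y) *: e 3.

Definition g2 : bracket K 2 2 := fun x y =>
  (coord 3 x * coord 4 y + coord 4 x * coord 3 y) *: e 1 +
  (coord 2 x * coord 3 y - coord 3 x * coord 2 y) *: e 3 -
  (coord 2 x * coord 4 y - coord 4 x * coord 2 y) *: e 4.

Let coordD k x y : coord k (x + y) = coord k x + coord k y.
Proof. by rewrite /coord mxE. Qed.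
Let coordZ k a x : coord k (a *: x) = a * coord k x.
Proof. by rewrite /coord mxE. Qed.
Let coordN k x : coord k (- x) = - coord k x.
Proof. by rewrite /coord mxE. Qed.

Let coord_e k l : (0 < k <= 4)%N -> (0 < l <= 4)%N -> coord k (e l) = (k == l)%:R.
Proof.
case: k l => [|k] [|l] //= hk hl.
by rewrite /coord /e mxE eqxx /= -val_eqE /= !inordK.
Qed.

Let coordP x y : coord 1 x = coord 1 y -> coord 2 x = coord 2 y ->
  coord 3 x = coord 3 y -> coord 4 x = coord 4 y -> x = y.
Proof.
rewrite /coord /= => h1 h2 h3 h4; apply/rowP => k; rewrite -[k]inord_val.
by case: k => [[|[|[|[|k]]]] Hk].
Qed.

Let homogeneousE a x : homogeneous a x <->
  (if a then coord 1 x = 0 /\ coord 2 x = 0 else coord 3 x = 0 /\ coord 4 x = 0).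
Proof.
split=> [h|]; first by case: a h => h; split; apply: h; rewrite inordK.
rewrite /coord; case: a => -[h1 h2] k; rewrite -[k]inord_val;
  by case: k => [[|[|[|[|k]]]] Hk]; rewrite inordK //= => _; exact: h1 || exact: h2.
Qed.

Let simp := (coordD, coordN, coordZ, coord_e).

Lemma g1_is_lie_superalgebra : is_lie_superalgebra g1.
Proof.
split.
- by move=> x c y z; apply: coordP; rewrite /g1 !simp //=; ring.
- by move=> x c y z; apply: coordP; rewrite /g1 !simp //=; ring.
- move=> [] [] x y /homogeneousE[h1 h2] /homogeneousE[h3 h4];
  apply/homogeneousE; split; rewrite /g1 !simp //= ?(h1, h2, h3, h4); ring.
- move=> [] [] x y /homogeneousE[h1 h2] /homogeneousE[h3 h4];
  apply: coordP; rewrite /g1 !simp //= ?(h1, h2, h3, h4); ring.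
- move=> [] [] x y z /homogeneousE[h1 h2] /homogeneousE[h3 h4];
  apply: coordP; rewrite /g1 !simp //= ?(h1, h2, h3, h4); ring.
Qed.

Lemma g2_is_lie_superalgebra : is_lie_superalgebra g2.
Proof.
split.
- by move=> x c y z; apply: coordP; rewrite /g2 !simp //=; ring.
- by move=> x c y z; apply: coordP; rewrite /g2 !simp //=; ring.
- move=> [] [] x y /homogeneousE[h1 h2] /homogeneousE[h3 h4];
  apply/homogeneousE; split; rewrite /g2 !simp //= ?(h1, h2, h3, h4); ring.
- move=> [] [] x y /homogeneousE[h1 h2] /homogeneousE[h3 h4];
  apply: coordP; rewrite /g2 !simp //= ?(h1, h2, h3, h4); ring.
- move=> [] [] x y z /homogeneousE[h1 h2] /homogeneousE[h3 h4];
  apply: coordP; rewrite /g2 !simp //= ?(h1, h2, h3, h4); ring.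
Qed.

End Examples.

Arguments g1 : clear implicits.
Arguments g2 : clear implicits.

(* Main.v *)
Require Import Defs.
From mathcomp Require Import all_boot all_order all_algebra.
From mathcomp Require Import complex.
From mathcomp Require Import all_classical all_reals all_analysis.
From mathcomp Require Import ring.

Set Implicit Arguments.
Unset Strict Implicit.
Unset Printing Implicit Defensive.

Import Order.TTheory GRing.Theory Num.Theory.
Import numFieldNormedType.Exports.
Local Open Scope ring_scope.
Local Open Scope complex_scope.

Local Notation coord := Defs.coord.
Local Notation cst := Defs.cst.

(** On a metric Lie superalgebra of rank [2|2] over a torsion-free ring the even
    part is abelian and acts on the odd part by commuting infinitesimally
    symplectic maps.  For a metric deformation of [g1], put f1 = [e4,e4],
    f2 = e2, f3 = [e2,e4] and f4 = e4; this is a basis, because it reduces to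
    e1, ..., e4 at t = 0.  The form forces [f2,f3] = tau f4 (the action of f2 is
    traceless), and the Jacobi identities then give f1 central, [f3,f4] = 0 and
    [f3,f3] = - tau f1.  So every metric deformation is equivalent to the normal
    form [nf tau] with tau(0) = 0, which is trivial for tau = 0 and is otherwise
    obtained from [nf t] by the change of parameter t := tau.  At a number z != 0
    the element e2 of [nf z] acts diagonalisably on the odd part, with
    eigenvalues the two square roots of z, and rescaling e2 turns the
    eigenvectors into the basis of [g2]. *)

(** * Coordinates and parity in rank [2|2] *)

Section Coordinates.
Context {A : comNzRingType}.
Implicit Types (x y z : 'rV[A]_(2 + 2)) (c : A).

Lemma coordD k x y : coord k (x + y) = coord k x + coord k y.
Proof. by rewrite /coord mxE. Qed.

Lemma coordZ k c x : coord k (c *: x) = c * coord k x.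
Proof. by rewrite /coord mxE. Qed.

Lemma coordN k x : coord k (- x) = - coord k x.
Proof. by rewrite /coord mxE. Qed.

Lemma coord_zero k : coord k (0 : 'rV[A]_(2 + 2)) = 0.
Proof. by rewrite /coord mxE. Qed.

Lemma coord_e k l : (0 < k <= 4)%N -> (0 < l <= 4)%N ->
  coord k (e A l) = (k == l)%:R.
Proof.
case: k l => [|k] [|l] //= hk hl.
by rewrite /coord /e mxE eqxx /= -val_eqE /= !inordK.
Qed.

Lemma coordP x y : coord 1 x = coord 1 y -> coord 2 x = coord 2 y ->
  coord 3 x = coord 3 y -> coord 4 x = coord 4 y -> x = y.
Proof.
rewrite /coord /= => h1 h2 h3 h4; apply/rowP => k; rewrite -[k]inord_val.
by case: k => [[|[|[|[|k]]]] Hk].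
Qed.

Lemma homogeneousE a x : homogeneous a x <->
  (if a then coord 1 x = 0 /\ coord 2 x = 0 else coord 3 x = 0 /\ coord 4 x = 0).
Proof.
split=> [h|]; first by case: a h => h; split; apply: h; rewrite inordK.
rewrite /coord; case: a => -[h1 h2] k; rewrite -[k]inord_val;
  by case: k => [[|[|[|[|k]]]] Hk]; rewrite inordK //= => _; exact: h1 || exact: h2.
Qed.

Lemma e_homogeneous k : (0 < k <= 4)%N -> homogeneous (2 < k)%N (e A k).
Proof.
by case: k => [|[|[|[|[|k]]]]] // _; apply/homogeneousE; rewrite /= !coord_e.
Qed.

Lemma coord_comb c1 c2 c3 c4 :
  let x := c1 *: e A 1 + c2 *: e A 2 + c3 *: e A 3 + c4 *: e A 4 in
  (coord 1 x = c1) * (coord 2 x = c2) * (coord 3 x = c3) * (coord 4 x = c4).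
Proof.
by rewrite /= !(coordD, coordZ) !coord_e //= !(mulr0, mulr1, addr0, add0r).
Qed.

Lemma row_coord x :
  x = coord 1 x *: e A 1 + coord 2 x *: e A 2 + coord 3 x *: e A 3
      + coord 4 x *: e A 4.
Proof. by apply: coordP; rewrite coord_comb. Qed.

End Coordinates.

Definition coordE := (@coordD, @coordN, @coordZ, @coord_zero, @coord_e).

(** * The normal form *)

Section NormalForm.
Context {A : comNzRingType}.

(** The double extension of the odd symplectic plane by the traceless map D with D e3 = tau e4 and D
    e4 = e3, so that D^2 = tau: e2 acts as D, and the e1-component of the bracket of odd x, y is
    [nf_form (D x) y]. *)
Definition nf (tau : A) : bracket A 2 2 := fun x y =>
  (coord 4 x * coord 4 y - tau * (coord 3 x * coord 3 y)) *: e A 1 +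
  (coord 2 x * coord 4 y - coord 4 x * coord 2 y) *: e A 3 +
  (tau * (coord 2 x * coord 3 y - coord 3 x * coord 2 y)) *: e A 4.

Definition nf_form (x y : 'rV[A]_(2 + 2)) : A :=
  coord 1 x * coord 2 y + coord 2 x * coord 1 y
  + coord 3 x * coord 4 y - coord 4 x * coord 3 y.

Lemma coord_nf tau x y :
  (coord 1 (nf tau x y) =
     coord 4 x * coord 4 y - tau * (coord 3 x * coord 3 y)) *
  (coord 2 (nf tau x y) = 0) *
  (coord 3 (nf tau x y) = coord 2 x * coord 4 y - coord 4 x * coord 2 y) *
  (coord 4 (nf tau x y) =
     tau * (coord 2 x * coord 3 y - coord 3 x * coord 2 y)).
Proof.
by rewrite /nf !coordE //= !(mulr0, mulr1, addr0, add0r).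
Qed.

Lemma nf0 : nf 0 = g1 A.
Proof.
apply/funext => x; apply/funext => y.
by apply: coordP; rewrite coord_nf /g1 !coordE //=; ring.
Qed.

(** Brackets lie in the span of the central elements e1 and e3. This invariant separates [g1] both
    from [nf fpsX] and from [g2]. *)
Lemma g1_nilpotent x y z : g1 A x (g1 A y z) = 0.
Proof.
by apply: coordP; rewrite -nf0 !coord_nf ?coord_zero; ring.
Qed.

Lemma nf_is_lie_superalgebra tau : is_lie_superalgebra (nf tau).
Proof.
split.
- by move=> x c y z; apply: coordP; rewrite !(coord_nf, coordE) //=; ring.
- by move=> x c y z; apply: coordP; rewrite !(coord_nf, coordE) //=; ring.
- move=> [] [] x y /homogeneousE[h1 h2] /homogeneousE[h3 h4];
  apply/homogeneousE; split; rewrite !(coord_nf, coordE) //= ?(h1, h2, h3, h4); ring.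
- move=> [] [] x y /homogeneousE[h1 h2] /homogeneousE[h3 h4];
  apply: coordP; rewrite !(coord_nf, coordE) //= ?(h1, h2, h3, h4); ring.
- move=> [] [] x y z /homogeneousE[h1 h2] /homogeneousE[h3 h4];
  apply: coordP; rewrite !(coord_nf, coordE) //= ?(h1, h2, h3, h4); ring.
Qed.

Lemma nf_form_invariant_metric tau : is_invariant_metric (nf tau) nf_form.
Proof.
split.
- by move=> x c y z; rewrite /nf_form !coordE //=; ring.
- by move=> x c y z; rewrite /nf_form !coordE //=; ring.
- by move=> [] [] x y /homogeneousE[h1 h2] /homogeneousE[h3 h4] // _;
  rewrite /nf_form ?(h1, h2, h3, h4); ring.
- by move=> [] [] x y /homogeneousE[h1 h2] /homogeneousE[h3 h4];
  rewrite /nf_form ?(h1, h2, h3, h4) /=; ring.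
- by move=> x y z; rewrite /nf_form !coord_nf; ring.
(* The dual basis: e1 and e2 are a hyperbolic pair, and the minus sign comes from B(e4,e3) = -1. *)
- move=> l; exists (l (e A 2) *: e A 1 + l (e A 1) *: e A 2
                    + l (e A 4) *: e A 3 - l (e A 3) *: e A 4).
  split=> [y|x lx].
    rewrite [in LHS](row_coord y) !linearD !linearZ /= /nf_form !coordE //=.
    by rewrite /GRing.scale /=; ring.
  by apply: coordP; rewrite !coordE //= !lx /nf_form !coord_e //=; ring.
Qed.

Lemma nf_is_metric tau : is_metric_lie_superalgebra (nf tau).
Proof.
by split; [exact: nf_is_lie_superalgebra|];
  exists nf_form; exact: nf_form_invariant_metric.
Qed.

End NormalForm.

(** The structure constants of [nf tau] are 0, 1, -1, tau and -tau, so an additive unital map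
    determines their images. It is applied to the embedding of constants and to substitution. *)
Lemma map_bracket_nf (A A' : comNzRingType) (f : A -> A') tau :
  (forall a c, f (a + c) = f a + f c) -> f 1 = 1 ->
  map_bracket f (nf tau) = nf (f tau).
Proof.
move=> fD f1.
have f0 : f 0 = 0 by apply: (addrI (f 0)); rewrite -fD !addr0.
have fN a : f (- a) = - f a by apply/eqP; rewrite -addr_eq0 -fD addNr f0.
have dE i : delta_mx 0 i = e A i.+1 by rewrite /e inord_val.
have cE k (v : 'rV[A]_(2 + 2)) : coord k (map_mx f v) = f (coord k v).
  by rewrite /coord mxE.
have iE (x : 'rV[A']_(2 + 2)) (i : 'I_(2 + 2)) : x 0 i = coord i.+1 x.
  by rewrite /coord inord_val.
apply/funext => x; apply/funext => y.
rewrite /map_bracket.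
under eq_bigr do under eq_bigr do rewrite !dE !iE.
rewrite !big_ord_recl !big_ord0 /= /bump /=.
apply: coordP; rewrite !coordE // !cE !coord_nf ?coord_e //=;
  rewrite !(mulr0, mul0r, mulr1, addr0, add0r, subr0, sub0r, oppr0,
            mulrN, fN, f0, f1); ring.
Qed.

(** * Formal power series *)

Section FpsTheory.
Context {K : comNzRingType}.
Implicit Types (f g h u : fps K) (c : K).

Definition fpsX : fps K := Fps (fun n => (n == 1)%N%:R).

Lemma fcoefD f g n : fcoef (f + g) n = fcoef f n + fcoef g n.
Proof. by []. Qed.

Lemma fcoefN f n : fcoef (- f) n = - fcoef f n.
Proof. by []. Qed.

Lemma fcoefB f g n : fcoef (f - g) n = fcoef f n - fcoef g n.
Proof. by []. Qed.

Lemma fcoef0 n : fcoef (0 : fps K) n = 0.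
Proof. exact: if_same. Qed.

Lemma fcoef1 n : fcoef (1 : fps K) n = (n == 0)%N%:R.
Proof. by case: n. Qed.

Lemma fcoefM f g n :
  fcoef (f * g) n = \sum_(i < n.+1) fcoef f i * fcoef g (n - i)%N.
Proof. by []. Qed.

Lemma fcoefM0 f g : fcoef (f * g) 0 = fcoef f 0 * fcoef g 0.
Proof. by rewrite fcoefM big_ord1. Qed.

Lemma fcoef_sum (I : Type) (r : seq I) (P : pred I) (F : I -> fps K) n :
  fcoef (\sum_(i <- r | P i) F i) n = \sum_(i <- r | P i) fcoef (F i) n.
Proof.
by apply: (big_morph (fun f => fcoef f n)) => [f g //|]; rewrite fcoef0.
Qed.

Lemma fcoefCM c f n : fcoef (fpsC c * f) n = c * fcoef f n.
Proof.
rewrite fcoefM big_ord_recl /= subn0 big1 ?addr0 // => i _.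
by rewrite mul0r.
Qed.

Lemma fcoefXM f n : fcoef (fpsX * f) n = if n is m.+1 then fcoef f m else 0.
Proof.
case: n => [|n]; first by rewrite fcoefM0 mul0r.
rewrite fcoefM big_ord_recl mul0r add0r big_ord_recl /= mul1r.
rewrite /bump /= subSS subn0 big1 ?addr0 // => i _.
by rewrite mul0r.
Qed.

Lemma fpsCD c1 c2 : fpsC (c1 + c2) = fpsC c1 + fpsC c2.
Proof. by apply: fpsP => -[|n] //=; rewrite addr0. Qed.

Lemma fpsC_nat n : fpsC n%:R = n%:R :> fps K.
Proof. by elim: n => [|n IHn] //; rewrite -!natr1 fpsCD IHn. Qed.

Lemma fcoef_exp_lt h k n : fcoef h 0 = 0 -> (n < k)%N -> fcoef (h ^+ k) n = 0.
Proof.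
move=> h0; elim: k n => [|k IHk] n //; rewrite ltnS => nk.
rewrite exprS fcoefM big_ord_recl h0 mul0r add0r big1 // => i _.
rewrite IHk ?mulr0 // (leq_trans _ nk) // /bump /= ltn_subrL.
by case: n i {nk} => [[]|].
Qed.

(** With f = 1 - h, the inverse is the geometric series of h. As h ^ k has order at least k, the
    n-th coefficient can be read off the partial sum [S n.+1], for which f S telescopes to 1 - h ^
    (n+1). *)
Lemma fps_left_inverse f : fcoef f 0 = 1 -> exists g, g * f = 1.
Proof.
move=> f0; pose h := 1 - f.
have h0 : fcoef h 0 = 0 by rewrite fcoefB fcoef1 f0 subrr.
have Ef : f = 1 - h by rewrite opprB addrC subrK.
pose S m := \sum_(k < m) h ^+ k.
have SE n m : (n < m)%N -> fcoef (S m) n = fcoef (S n.+1) n.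
  move=> nm; rewrite !fcoef_sum (big_ord_widen _ (fun k => fcoef (h ^+ k) n) nm).
  rewrite [RHS]big_mkcond /=; apply: eq_bigr => k _.
  by case: ltnP => // nk; rewrite fcoef_exp_lt.
exists (Fps (fun n => fcoef (S n.+1) n)); rewrite mulrC; apply: fpsP => n.
transitivity (fcoef (f * S n.+1) n).
  rewrite !fcoefM; apply: eq_bigr => i _ /=.
  by congr (_ * _); rewrite [RHS]SE // ltnS leq_subr.
have -> : f * S n.+1 = 1 - h ^+ n.+1.
  by rewrite /S -[RHS]opprB subrX1 -mulNr opprB -Ef.
by rewrite fcoefB fcoef_exp_lt // subr0.
Qed.

Lemma fps_substD u f g : fps_subst u (f + g) = fps_subst u f + fps_subst u g.
Proof.
apply: fpsP => n; rewrite fcoefD /= -big_split /=.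
by apply: eq_bigr => k _; rewrite mulrDl.
Qed.

Lemma fps_subst1 u : fps_subst u 1 = 1.
Proof.
apply: fpsP => n; rewrite /= big_ord_recl mul1r expr0 big1 ?addr0 // => k _.
by rewrite mul0r.
Qed.

Lemma fps_substX u : fcoef u 0 = 0 -> fps_subst u fpsX = u.
Proof.
move=> u0; apply: fpsP => -[|n] /=.
  by rewrite big_ord1 mul0r u0.
rewrite big_ord_recl mul0r add0r big_ord_recl mul1r expr1 big1 ?addr0 // => k _.
by rewrite mul0r.
Qed.

End FpsTheory.

(** * Deformations *)

Section Deformations.
Context {K : comNzRingType}.
Implicit Types (x y : 'rV[K]_(2 + 2)) (v w : 'rV[fps K]_(2 + 2)).

Lemma coord_vcoef n k v : coord k (vcoef n v) = fcoef (coord k v) n.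
Proof. by rewrite /coord mxE. Qed.

Lemma coord_cst k x : coord k (cst x) = fpsC (coord k x).
Proof. by rewrite /coord mxE. Qed.

Lemma cst_e k : cst (e K k) = e (fps K) k.
Proof. by apply/rowP => i; rewrite !mxE fpsC_nat. Qed.

Lemma vcoef0_cst x : vcoef 0 (cst x) = x.
Proof. by apply: coordP; rewrite coord_vcoef coord_cst. Qed.

Lemma nf_metric_deformation (tau : fps K) :
  fcoef tau 0 = 0 -> is_metric_deformation (g1 K) (nf tau).
Proof.
move=> tau0; split; last exact: nf_is_metric.
split=> [|x y]; first exact: nf_is_lie_superalgebra.
by apply: coordP; rewrite coord_vcoef coord_nf -?nf0 ?coord_nf
  ?(fcoefD, fcoefN, fcoefM0, fcoef0, tau0, coord_cst) //=; ring.
Qed.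

Lemma map_bracket_g1 : map_bracket (@fpsC K) (g1 K) = g1 (fps K).
Proof. by rewrite -!nf0 map_bracket_nf //; exact: fpsCD. Qed.

(** In [nf fpsX] one has [e2,[e2,e3]] = t e3. An equivalence to the two-step nilpotent [g1] would
    send this to 0, whereas the coefficient of t in the image of t e3 is e3. *)
Lemma nf_X_nontrivial : ~ is_trivial_deformation (g1 K) (nf fpsX).
Proof.
case=> psi [psi_lin _ psi0]; rewrite map_bracket_g1 => psiM.
pose E k := e (fps K) k.
have E3 : nf fpsX (E 2%N) (nf fpsX (E 2%N) (E 3%N)) = fpsX *: E 3%N.
  by apply: coordP; rewrite !(coord_nf, coordE) //=; ring.
have /(congr1 (fun v => fcoef (coord 3 v) 1)) := congr1 psi E3.
rewrite !psiM g1_nilpotent -[fpsX *: _]addr0 psi_lin.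
have -> : psi 0 = 0.
  by have := psi_lin (-1) 0 0; rewrite scaler0 addr0 scaleN1r addNr.
rewrite addr0 coordZ fcoefXM coord_zero -coord_vcoef /E -cst_e psi0 coord_e //=.
by move/eqP; rewrite eq_sym oner_eq0.
Qed.

Lemma change_parameter_nf (u : fps K) : fcoef u 0 = 0 ->
  change_parameter u (nf fpsX) = nf u.
Proof.
move=> u0; rewrite /change_parameter map_bracket_nf ?fps_substX //.
  exact: fps_substD.
exact: fps_subst1.
Qed.

End Deformations.

(** * Classification of the metric deformations *)

Section MetricBrackets.
Context {A : comNzRingType} (b : bracket A 2 2).
Context (B : 'rV[A]_(2 + 2) -> 'rV[A]_(2 + 2) -> A).
Hypotheses (b_lie : is_lie_superalgebra b) (B_metric : is_invariant_metric b B).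
(** Characteristic zero for a ring that need not be a field; it cancels the integer factors produced
    by skew-symmetry and Jacobi. *)
Hypothesis A_torsion_free : forall n (a : A), a *+ n.+1 = 0 -> a = 0.
Implicit Types (x y z w : 'rV[A]_(2 + 2)) (c : A).

Lemma row_torsion_free n x : x *+ n.+1 = 0 -> x = 0.
Proof.
move=> xn0; apply/rowP => i; rewrite mxE; apply: (@A_torsion_free n).
by rewrite -mulmxnE xn0 mxE.
Qed.

Lemma bracketDl x y z : b (x + y) z = b x z + b y z.
Proof. by have := lie_linearl b_lie z 1 x y; rewrite !scale1r. Qed.

Lemma bracketDr x y z : b x (y + z) = b x y + b x z.
Proof. by have := lie_linearr b_lie x 1 y z; rewrite !scale1r. Qed.

Lemma bracket0l x : b 0 x = 0.
Proof. by apply: (addrI (b 0 x)); rewrite -bracketDl !addr0. Qed.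

Lemma bracket0r x : b x 0 = 0.
Proof. by apply: (addrI (b x 0)); rewrite -bracketDr !addr0. Qed.

Lemma bracketZl c x y : b (c *: x) y = c *: b x y.
Proof.
by have := lie_linearl b_lie y c x 0; rewrite !addr0 bracket0l addr0.
Qed.

Lemma bracketZr c x y : b x (c *: y) = c *: b x y.
Proof.
by have := lie_linearr b_lie x c y 0; rewrite !addr0 bracket0r addr0.
Qed.

Lemma formDl x y z : B (x + y) z = B x z + B y z.
Proof. by have := metric_linearl B_metric z 1 x y; rewrite scale1r mul1r. Qed.

Lemma formDr x y z : B x (y + z) = B x y + B x z.
Proof. by have := metric_linearr B_metric x 1 y z; rewrite scale1r mul1r. Qed.

Lemma form0l x : B 0 x = 0.
Proof. by apply: (addrI (B 0 x)); rewrite -formDl !addr0. Qed.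

Lemma form0r x : B x 0 = 0.
Proof. by apply: (addrI (B x 0)); rewrite -formDr !addr0. Qed.

Lemma formZl c x y : B (c *: x) y = c * B x y.
Proof.
by have := metric_linearl B_metric y c x 0; rewrite !addr0 form0l addr0.
Qed.

Lemma formZr c x y : B x (c *: y) = c * B x y.
Proof.
by have := metric_linearr B_metric x c y 0; rewrite !addr0 form0r addr0.
Qed.

(** Uniqueness of the vector representing the zero functional. *)
Lemma form_nondegenerate x :
  (forall k, (0 < k <= 4)%N -> B x (e A k) = 0) -> x = 0.
Proof.
move=> Bx0; have [w [_ w_uniq]] := metric_nondegenerate B_metric \0.
have <- : w = x.
  apply: w_uniq => y.
  by rewrite (row_coord y) !formDr !formZr !Bx0 // !mulr0 !addr0.
by apply: w_uniq => y; rewrite form0l.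
Qed.

Lemma form_odd_sym x y : homogeneous true x -> homogeneous true y ->
  B y x = - B x y.
Proof.
by move=> hx hy; rewrite (Defs.metric_sym B_metric hx hy) expr1 mulN1r.
Qed.

Lemma form_odd_self x : homogeneous true x -> B x x = 0.
Proof.
move=> hx; apply: (@A_torsion_free 1).
by rewrite mulr2n {1}(form_odd_sym hx hx) addNr.
Qed.

Lemma bracket_skew x y a : homogeneous false x -> homogeneous a y ->
  b y x = - b x y.
Proof. by move=> hx hy; rewrite (lie_skew b_lie hx hy) scale1r. Qed.

Lemma bracket_even_self x : homogeneous false x -> b x x = 0.
Proof.
move=> hx; apply: (@row_torsion_free 1).
by rewrite mulr2n {1}(bracket_skew hx hx) addNr.
Qed.

(* For even x and y, invariance makes [x,y] orthogonal to x, to y and to the odd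
   part; in even rank 2 this is everything. *)
Lemma bracket_even_even x y : homogeneous false x -> homogeneous false y ->
  b x y = 0.
Proof.
have h1 := @e_homogeneous A 1 isT; have h2 := @e_homogeneous A 2 isT.
have h12 : homogeneous false (b (e A 1) (e A 2)) := lie_graded b_lie h1 h2.
have b12 : b (e A 1) (e A 2) = 0.
  apply: form_nondegenerate => -[|[|[|k]]] // hk; last first.
  - exact: (metric_even B_metric h12 (e_homogeneous hk)).
  - by rewrite (metric_invariant B_metric) (bracket_even_self h2) form0r.
  - rewrite (bracket_skew h2 h1) -scaleN1r formZl (metric_invariant B_metric).
    by rewrite (bracket_even_self h1) form0r mulr0.
have b21 : b (e A 2) (e A 1) = 0 by rewrite (bracket_skew h1 h2) b12 oppr0.
move=> /homogeneousE [x3 x4] /homogeneousE [y3 y4].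
rewrite (row_coord x) (row_coord y) x3 x4 y3 y4 !scale0r !addr0.
rewrite !(bracketDl, bracketDr, bracketZl, bracketZr).
by rewrite (bracket_even_self h1) (bracket_even_self h2) b12 b21 !(scaler0, addr0).
Qed.

Local Notation f1 := (b (e A 4) (e A 4)).
Local Notation f2 := (e A 2).
Local Notation f3 := (b (e A 2) (e A 4)).
Local Notation f4 := (e A 4).

Let h2 : homogeneous false f2 := @e_homogeneous A 2 isT.
Let h4 : homogeneous true f4 := @e_homogeneous A 4 isT.
Let h1 : homogeneous false f1 := lie_graded b_lie h4 h4.
Let h3 : homogeneous true f3 := lie_graded b_lie h2 h4.

(** Jacobi on three copies of f4 gives 3 [f1,f4] = 0. *)
Lemma bracket_f1f4 : b f1 f4 = 0.
Proof.
have J := lie_jacobi b_lie f4 h4 h4; rewrite /= expr1 scaleN1r in J.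
have S : b f4 f1 = - b f1 f4 := bracket_skew h1 h4.
rewrite S opprK in J.
by apply: (@row_torsion_free 2); rewrite mulrS mulr2n -J subrr.
Qed.

(** f1 commutes with f2 and with f4, hence with f3 = [f2,f4]. *)
Lemma bracket_f1f3 : b f1 f3 = 0.
Proof.
rewrite (lie_jacobi b_lie f4 h1 h2) /= (bracket_even_even h1 h2).
by rewrite bracket_f1f4 bracket0l bracket0r scaler0 addr0.
Qed.

(** Applying f2 to f1 = [f4,f4] gives [f2,f1] = 2 [f3,f4], and the even part is abelian. *)
Lemma bracket_f3f4 : b f3 f4 = 0.
Proof.
have := lie_jacobi b_lie f4 h2 h4.
rewrite /= scale1r (bracket_even_even h2 h1) (lie_skew b_lie h3 h4) expr1.
rewrite scaleN1r opprK -mulr2n => /esym; exact: row_torsion_free.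
Qed.

(** Write [f2,f3] = p f3 + tau f4. Invariance gives B([f2,f3],f4) = - B(f3,[f2,f4]) = - B(f3,f3) =
    0, hence p B(f3,f4) = 0. Then p f3 is orthogonal to every basis vector and vanishes. *)
Lemma bracket_f2f3 c : c * coord 3 f3 = 1 -> exists tau, b f2 f3 = tau *: f4.
Proof.
move=> cE; have h23 : homogeneous true (b f2 f3) := lie_graded b_lie h2 h3.
have /homogeneousE [f31 f32] := h3; have /homogeneousE [f231 f232] := h23.
(* Since f4 = e4, the change of basis from e3, e4 to f3, f4 is triangular with the unit [coord 3 f3]
   on its diagonal; p and [tau] come from solving it. *)
pose d := coord 4 f3; pose p := coord 3 (b f2 f3) * c.
pose tau := coord 4 (b f2 f3) - p * d.
have e3E : e A 3 = c *: f3 - (c * d) *: f4.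
  apply: coordP; rewrite !(coordD, coordN, coordZ) ?coord_e // ?(f31, f32, cE) /d;
  by rewrite /=; ring.
have f23E : b f2 f3 = p *: f3 + tau *: f4.
  apply: coordP; rewrite !(coordD, coordN, coordZ) ?coord_e //
    ?(f31, f32, f231, f232) /=.
  - by ring.
  - by ring.
  - by rewrite /p -mulrA cE; ring.
  - by rewrite /tau /d; ring.
have B33 := form_odd_self h3; have B44 := form_odd_self h4.
have pB : p * B f3 f4 = 0.
  have : B (b f2 f3) f4 = 0.
    rewrite -[b f2 f3]opprK -(bracket_skew h2 h3) -scaleN1r formZl.
    by rewrite (metric_invariant B_metric) B33 mulr0.
  by rewrite f23E formDl !formZl B44 mulr0 addr0.
exists tau; rewrite f23E.
suff -> : p *: f3 = 0 by rewrite add0r.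
apply: form_nondegenerate => k hk; rewrite formZl.
case: k hk => [|[|[|[|[|k]]]]] // hk.
- by rewrite (metric_even B_metric h3 (e_homogeneous hk)) ?mulr0.
- by rewrite (metric_even B_metric h3 (e_homogeneous hk)) ?mulr0.
- rewrite e3E -scaleNr formDr !formZr B33 mulr0 add0r mulrCA pB; ring.
Qed.

(** Apply f2 as a derivation to [f3,f4] = 0. *)
Lemma bracket_f3f3 tau : b f2 f3 = tau *: f4 -> b f3 f3 = - (tau *: f1).
Proof.
move=> f23E; have := lie_jacobi b_lie f4 h2 h3.
rewrite /= scale1r bracket_f3f4 bracket0r f23E bracketZl => /esym/eqP.
by rewrite addrC addr_eq0 => /eqP.
Qed.

Definition adapted_map (y : 'rV[A]_(2 + 2)) : 'rV[A]_(2 + 2) :=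
  coord 1 y *: f1 + coord 2 y *: f2 + coord 3 y *: f3 + coord 4 y *: f4.

Lemma adapted_map_nf tau x y : b f2 f3 = tau *: f4 ->
  b (adapted_map x) (adapted_map y) = adapted_map (nf tau x y).
Proof.
move=> f23E; rewrite /adapted_map !coord_nf.
rewrite !(bracketDl, bracketDr, bracketZl, bracketZr).
rewrite (bracket_f3f3 f23E) (bracket_skew h2 h3) f23E.
rewrite (bracket_even_self h1) (bracket_even_self h2).
rewrite (bracket_even_even h1 h2) (bracket_even_even h2 h1).
rewrite (bracket_skew h1 h4) (bracket_skew h1 h3) (bracket_skew h2 h4).
rewrite bracket_f1f4 bracket_f1f3 (lie_skew b_lie h3 h4) bracket_f3f4.
(* f1 and f3 become arbitrary vectors, so that [ring] sees atoms; this local [g1] is not the Lie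
   superalgebra. *)
move: f1 f3 => g1 g3; apply/rowP => i; rewrite !mxE; ring.
Qed.

End MetricBrackets.

(** * Equivalence with the normal form over power series *)

Section Classification.
Context {K : numFieldType}.
Implicit Types (x y : 'rV[fps K]_(2 + 2)).

Lemma fps_torsion_free n (f : fps K) : f *+ n.+1 = 0 -> f = 0.
Proof.
move=> fn0; apply: fpsP => m.
have fcoefMn k : fcoef (f *+ k) m = fcoef f m *+ k.
  by elim: k => [|k IHk]; rewrite ?mulr0n ?fcoef0 // !mulrS fcoefD IHk.
have /eqP := fcoefMn n.+1.
by rewrite fn0 fcoef0 eq_sym mulrn_eq0 /= => /eqP ->.
Qed.

(** A deformation is compared with [g] on constant vectors only. Any vector is a constant plus a
    multiple of t, and bilinearity removes that multiple at t = 0. *)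
Lemma vcoef0_bracket (g : bracket K 2 2) (bt : bracket (fps K) 2 2) x y :
  is_deformation g bt -> vcoef 0 (bt x y) = g (vcoef 0 x) (vcoef 0 y).
Proof.
case=> bt_lie bt0.
have split0 x' : exists x1, x' = fpsX *: x1 + cst (vcoef 0 x').
  exists (map_mx (fun f => Fps (fun n => fcoef f n.+1)) x').
  apply/rowP => i; rewrite !mxE; apply: fpsP => n.
  rewrite fcoefD fcoefXM; case: n => [|n]; first by rewrite add0r.
  by rewrite /= addr0.
have vcoef0X v w : vcoef 0 (fpsX *: v + w) = vcoef 0 w.
  by apply/rowP => i; rewrite !mxE fcoefD fcoefXM add0r.
have [x1 Ex] := split0 x; have [y1 Ey] := split0 y.
rewrite [in LHS]Ex (lie_linearl bt_lie) vcoef0X.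
by rewrite [in LHS]Ey (lie_linearr bt_lie) vcoef0X bt0.
Qed.

Lemma metric_deformation_nf (bt : bracket (fps K) 2 2) :
  is_metric_deformation (g1 K) bt ->
  exists tau, fcoef tau 0 = 0 /\ equivalent_deformations bt (nf tau).
Proof.
case=> bt_def [bt_lie [B B_metric]].
have vcoef0_e k : vcoef 0 (e (fps K) k) = e K k by rewrite -cst_e vcoef0_cst.
pose f1 := bt (e _ 4) (e _ 4); pose f3 := bt (e _ 2) (e _ 4).
have f1_0 : vcoef 0 f1 = e K 1.
  rewrite (vcoef0_bracket _ _ bt_def) !vcoef0_e -nf0.
  by apply: coordP; rewrite coord_nf ?coord_e //=; ring.
have f3_0 : vcoef 0 f3 = e K 3.
  rewrite (vcoef0_bracket _ _ bt_def) !vcoef0_e -nf0.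
  by apply: coordP; rewrite coord_nf ?coord_e //=; ring.
have h2 := @e_homogeneous (fps K) 2 isT; have h4 := @e_homogeneous (fps K) 4 isT.
have /homogeneousE [f13 f14] : homogeneous false f1 := lie_graded bt_lie h4 h4.
have /homogeneousE [f31 f32] : homogeneous true f3 := lie_graded bt_lie h2 h4.
have [a aE] : exists a, a * coord 1 f1 = 1.
  by apply: fps_left_inverse; rewrite -coord_vcoef f1_0 coord_e.
have [c cE] : exists c, c * coord 3 f3 = 1.
  by apply: fps_left_inverse; rewrite -coord_vcoef f3_0 coord_e.
have [tau tauE] := bracket_f2f3 bt_lie B_metric fps_torsion_free cE.
exists tau; split.
  (* At t = 0 the relation reads [e2,e3] = tau(0) e4 in [g1], where e2 and e3 commute. *)
  have := congr1 (vcoef 0) tauE.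
  rewrite (vcoef0_bracket _ _ bt_def) vcoef0_e -/f3 f3_0 => /(congr1 (coord 4)).
  by rewrite coord_vcoef coordZ coord_e // mulr1 -nf0 coord_nf mul0r => <-.
(* The inverse of [adapted_map bt], which is triangular on the even and on the odd part, with
   diagonal entries 1 and the units inverted by [a] and [c]. *)
pose psi x := (a * coord 1 x) *: e _ 1
  + (coord 2 x - a * coord 2 f1 * coord 1 x) *: e _ 2
  + (c * coord 3 x) *: e _ 3
  + (coord 4 x - c * coord 4 f3 * coord 3 x) *: e (fps K) 4.
have coord_psi x : (coord 1 (psi x) = a * coord 1 x) *
    (coord 2 (psi x) = coord 2 x - a * coord 2 f1 * coord 1 x) *
    (coord 3 (psi x) = c * coord 3 x) *
    (coord 4 (psi x) = coord 4 x - c * coord 4 f3 * coord 3 x).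
  exact: coord_comb.
clearbody psi.
have coord_phi y : let z := adapted_map bt y in
    (coord 1 z = coord 1 y * coord 1 f1) *
    (coord 2 z = coord 1 y * coord 2 f1 + coord 2 y) *
    (coord 3 z = coord 3 y * coord 3 f3) *
    (coord 4 z = coord 3 y * coord 4 f3 + coord 4 y).
  rewrite /adapted_map -/f1 -/f3 !(coordD, coordZ) !coord_e //=.
  by rewrite f13 f14 f31 f32 !(mulr0, mulr1, addr0, add0r).
have psiK x : adapted_map bt (psi x) = x.
  apply: coordP; rewrite coord_phi !coord_psi.
  - by rewrite mulrAC aE mul1r.
  - by ring.
  - by rewrite mulrAC cE mul1r.
  - by ring.
have phiK y : psi (adapted_map bt y) = y.
  apply: coordP; rewrite coord_psi !coord_phi.
  - by rewrite mulrCA aE mulr1.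
  - by ring: aE.
  - by rewrite mulrCA cE mulr1.
  - by ring: cE.
have f1_coef k : fcoef (coord k f1) 0 = coord k (e K 1).
  by rewrite -coord_vcoef f1_0.
have f3_coef k : fcoef (coord k f3) 0 = coord k (e K 3).
  by rewrite -coord_vcoef f3_0.
have a0 : fcoef a 0 = 1.
  by have := congr1 (fun f => fcoef f 0) aE; rewrite fcoefM0 f1_coef coord_e // mulr1.
have c0 : fcoef c 0 = 1.
  by have := congr1 (fun f => fcoef f 0) cE; rewrite fcoefM0 f3_coef coord_e // mulr1.
have psi0 (v : 'rV[K]_(2 + 2)) : vcoef 0 (psi (cst v)) = v.
  apply: coordP; rewrite coord_vcoef coord_psi ?fcoefB !fcoefM0 !coord_cst
    ?(f1_coef, f3_coef) ?coord_e // ?(a0, c0) /=; ring.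
exists psi; split; last 2 first.
- exact: psi0.
- move=> x y; rewrite -[x in LHS]psiK -[y in LHS]psiK.
  rewrite (adapted_map_nf bt_lie B_metric fps_torsion_free (psi x) (psi y) tauE).
  exact: phiK.
- by move=> k x y; apply: coordP; rewrite !(coordD, coordZ, coord_psi); ring.
- move=> [] x /homogeneousE [x1 x2]; apply/homogeneousE.
    by rewrite !coord_psi x1 x2 !(mulr0, subr0).
  by rewrite !coord_psi x1 x2 !(mulr0, subr0).
Qed.

End Classification.

(** * The jump *)

(** The bracket is affine in t on constant vectors, so the partial sums are constant from the second
    on. *)
Lemma nf_X_value_at (K : numFieldType) (z : K) : is_value_at (nf fpsX) z (nf z).
Proof.
move=> x y k; apply: cvg_near_cst.
near=> n.
have /subnK <- : (2 <= n)%N by near: n; exact: nbhs_infty_ge.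
(* [w] is the coefficient of t in the bracket of x and y. *)
pose w := (- (coord 3 x * coord 3 y)) *: e K 1 + 0 *: e K 2 + 0 *: e K 3
  + (coord 2 x * coord 3 y - coord 3 x * coord 2 y) *: e K 4.
have coord_w : (coord 1 w = - (coord 3 x * coord 3 y)) * (coord 2 w = 0) *
    (coord 3 w = 0) *
    (coord 4 w = coord 2 x * coord 3 y - coord 3 x * coord 2 y).
  exact: coord_comb.
clearbody w.
have E m : vcoef m (nf fpsX (cst x) (cst y)) =
    if m is m'.+1 then if m' is 0 then w else 0 else nf 0 x y.
  apply: coordP; rewrite coord_vcoef coord_nf ?coord_cst; case: m => [|[|m]];
    rewrite ?(fcoefB, fcoefXM, fcoefCM, fcoef0) ?coord_nf
      ?coord_w ?coord_zero /=; ring.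
have -> : nf z x y = nf 0 x y + z *: w.
  by apply: coordP; rewrite [LHS]coord_nf coordD coordZ coord_w coord_nf; ring.
rewrite /series /= addn2 big_mkord big_ord_recl big_ord_recl big1 => [|i _].
  by rewrite !E !mxE; ring.
by rewrite E mxE mul0r.
Unshelve. all: by end_near.
Qed.

Lemma coord_g2 (A : comNzRingType) (x y : 'rV[A]_(2 + 2)) :
  (coord 1 (g2 A x y) = coord 3 x * coord 4 y + coord 4 x * coord 3 y) *
  (coord 2 (g2 A x y) = 0) *
  (coord 3 (g2 A x y) = coord 2 x * coord 3 y - coord 3 x * coord 2 y) *
  (coord 4 (g2 A x y) = coord 4 x * coord 2 y - coord 2 x * coord 4 y).
Proof.
rewrite /g2 !(coordD, coordN, coordZ) !coord_e //=.
by rewrite !(mulr0, mulr1, oppr0, addr0, add0r) opprB.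
Qed.

(** An isomorphism would carry two-step nilpotency over to [g2], where [e2,[e2,e3]] = e3. *)
Lemma g1_not_isomorphic_g2 (K : numFieldType) : ~ isomorphic (g1 K) (g2 K).
Proof.
case=> f [f_lin _ [f' fK f'K] fM].
have f0 : f 0 = 0.
  by have := f_lin (-1) 0 0; rewrite scaler0 addr0 scaleN1r addNr.
have g2_nil x y z : g2 K x (g2 K y z) = 0.
  by rewrite -(f'K x) -(f'K y) -(f'K z) -!fM g1_nilpotent f0.
have /(congr1 (coord 3)) := g2_nil (e K 2) (e K 2) (e K 3).
rewrite !(coord_g2, coord_zero) !coord_e //= => /eqP.
by rewrite !(mul0r, mulr1, subr0) oner_eq0.
Qed.

Lemma nf_isomorphic_g2 (K : numFieldType) (s : K) :
  s != 0 -> isomorphic (nf (s ^+ 2)) (g2 K).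
Proof.
(* The inverse f' of f sends the basis of g2 to - 2 s^2 e1, e2 / s and the
   eigenvectors e3 + s e4, e3 - s e4 of e2. *)
move=> s0; have n2 : (2 : K) != 0 by rewrite pnatr_eq0.
pose f (x : 'rV[K]_(2 + 2)) := (- coord 1 x / (2 * s ^+ 2)) *: e K 1
  + (s * coord 2 x) *: e K 2
  + ((coord 3 x + coord 4 x / s) / 2) *: e K 3
  + ((coord 3 x - coord 4 x / s) / 2) *: e K 4.
pose f' (x : 'rV[K]_(2 + 2)) := (- (2 * s ^+ 2 * coord 1 x)) *: e K 1
  + (coord 2 x / s) *: e K 2
  + (coord 3 x + coord 4 x) *: e K 3
  + (s * (coord 3 x - coord 4 x)) *: e K 4.
have coord_f x : (coord 1 (f x) = - coord 1 x / (2 * s ^+ 2)) *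
    (coord 2 (f x) = s * coord 2 x) *
    (coord 3 (f x) = (coord 3 x + coord 4 x / s) / 2) *
    (coord 4 (f x) = (coord 3 x - coord 4 x / s) / 2).
  exact: coord_comb.
have coord_f' x : (coord 1 (f' x) = - (2 * s ^+ 2 * coord 1 x)) *
    (coord 2 (f' x) = coord 2 x / s) *
    (coord 3 (f' x) = coord 3 x + coord 4 x) *
    (coord 4 (f' x) = s * (coord 3 x - coord 4 x)).
  exact: coord_comb.
exists f; split.
- move=> k x y; apply: coordP; rewrite !(coordD, coordZ, coord_f); field;
  by rewrite ?n2 ?s0.
- move=> [] x /homogeneousE [x1 x2]; apply/homogeneousE; rewrite !coord_f x1 x2;
  by rewrite !(mulr0, mul0r, oppr0, addr0).
- exists f' => x; apply: coordP;
  rewrite ?(coord_f, coord_f') ?(coord_f, coord_f'); field; by rewrite ?n2 ?s0.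
- move=> x y; apply: coordP; rewrite !(coord_f, coord_nf, coord_g2); field;
  by rewrite ?n2 ?s0.
Qed.

Lemma nf_X_jump (K : numClosedFieldType) :
  is_jump_deformation (g1 K) (nf fpsX) (g2 K).
Proof.
split; last exact: g1_not_isomorphic_g2.
near=> z; exists (nf z); split; first exact: nf_X_value_at.
rewrite -[z]sqrtCK; apply: nf_isomorphic_g2; rewrite sqrtC_eq0.
by near: z; exact: nbhs_dnbhs_neq.
Unshelve. all: by end_near.
Qed.

Unset Implicit Arguments.

Theorem theorem3p1p1 (R : realType) :
  exists bt : bracket (fps R[i]) 2 2,
    [/\ is_metric_deformation (g1 R[i]) bt,
        ~ is_trivial_deformation (g1 R[i]) bt,
        is_jump_deformation (g1 R[i]) bt (g2 R[i]) &
        forall bt' : bracket (fps R[i]) 2 2,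
          is_metric_deformation (g1 R[i]) bt' ->
          ~ is_trivial_deformation (g1 R[i]) bt' ->
          exists u : fps R[i], is_parameter_change u /\
            equivalent_deformations bt' (change_parameter u bt)].
Proof.
exists (nf fpsX); split.
- exact: nf_metric_deformation.
- exact: nf_X_nontrivial.
- exact: nf_X_jump.
move=> bt' /metric_deformation_nf [u [u0 bt'E]] bt'_nontriv.
(* If [u] were 0, [bt'] would be equivalent to [nf 0], the undeformed bracket, hence trivial. *)
exists u; rewrite change_parameter_nf //; split=> //; split=> // uE.
by apply: bt'_nontriv; rewrite /is_trivial_deformation map_bracket_g1 -nf0 -uE.
Qed.
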